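(* A valuation $\nu$ on $K[x]$ is valuation-transcendental if and only if there exists a (nonconstant) polynomial $q\in K[x]$ such that $\nu=\nu_q$.
   Context: Setting: $K$ is a field and $\nu:K[x]\to\Gamma\cup\{\infty\}$ is a valuation on the polynomial ring in one indeterminate, with $\Gamma$ a totally ordered abelian group, i.e. $\nu(fg)=\nu(f)+\nu(g)$, $\nu(f+g)\ge\min\{\nu(f),\nu(g)\}$, $\nu(1)=0$, $\nu(0)=\infty$. It is assumed that the support of $\nu$ is zero, i.e. $\nu(f)=\infty$ only for $f=0$, so that $\nu$ extends uniquely to the field $K(x)$. Notation: $\nu K$ and $\nu(K(x))$ are the value groups of $\nu|_K$ and of $\nu$ on $K(x)$; $K\nu$ and $K(x)\nu$ are the corresponding residue fields. The valuation $\nu$ is valuation-algebraic if $\nu(K(x))/\nu K$ is a torsion group and $K(x)\nu\mid K\nu$ is an algebraic field extension; otherwise it is valuation-transcendental. Truncation: for a nonconstant $q\in K[x]$, every $p\in K[x]$ has a unique $q$-expansion $p=p_0+p_1q+\cdots+p_nq^n$ with each $p_i\in K[x]$ zero or of degree $<\deg(q)$; the $q$-truncation of $\nu$ is the map $\nu_q(p):=\min_{0\le i\le n}\{\nu(p_iq^i)\}$. *)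

(* Defs.v *)
From HB Require Import structures.
From mathcomp Require Import all_boot all_order all_algebra.

Set Implicit Arguments.
Unset Strict Implicit.
Unset Printing Implicit Defensive.

Import Order.TTheory GRing.Theory.
Local Open Scope ring_scope.
Local Open Scope quotient_scope.

(* Totally ordered abelian groups, written additively. The type
   [porderZmodType] alone does not relate the order to the addition. *)
Record orderedGroupType := OrderedGroup {
  oag_sort :> porderZmodType;
  oag_le_total : total (<=%R : rel oag_sort);
  oag_leD2l : forall c a b : oag_sort, a <= b -> c + a <= c + b
}.

(* G together with a point at infinity: [None] is infinity, the greatest
   element (denoted \top), and it is absorbing for the addition. *)
Definition extended (G : orderedGroupType) : Type := option G.
Definition fin (G : orderedGroupType) (a : G) : extended G := Some a.

Notation infty := (Order.top : extended _).

Section Extended.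
Variable G : orderedGroupType.
Implicit Types (a b c : G) (x y z : extended G).

HB.instance Definition _ := Choice.on (extended G).

Definition ext_le x y :=
  match x, y with
  | _, None => true
  | None, Some _ => false
  | Some a, Some b => a <= b
  end.

Fact ext_le_refl : reflexive ext_le.
Proof. by case=> [a|] /=. Qed.

Fact ext_le_anti : antisymmetric ext_le.
Proof. by case=> [a|] [b|] //= /le_anti ->. Qed.

Fact ext_le_trans : transitive ext_le.
Proof. by move=> [b|] [a|] [c|] //=; apply: le_trans. Qed.

Fact ext_le_total : total ext_le.
Proof. by case=> [a|] [b|] //=; apply: oag_le_total. Qed.

HB.instance Definition _ := Order.Le_isPOrder.Build ring_display (extended G)
  ext_le_refl ext_le_anti ext_le_trans.
HB.instance Definition _ :=
  Order.POrder_isTotal.Build ring_display (extended G) ext_le_total.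

Fact ext_le_top x : x <= (None : extended G).
Proof. by case: x. Qed.

HB.instance Definition _ :=
  Order.hasTop.Build ring_display (extended G) ext_le_top.

Definition ext_add x y : extended G :=
  match x, y with
  | Some a, Some b => Some (a + b)
  | _, _ => None
  end.

Fact ext_addA : associative ext_add.
Proof. by move=> [a|] [b|] [c|] //=; rewrite addrA. Qed.

Fact ext_addC : commutative ext_add.
Proof. by move=> [a|] [b|] //=; rewrite addrC. Qed.

Fact ext_add0 : left_id (fin 0) ext_add.
Proof. by move=> [a|] //=; rewrite add0r. Qed.

HB.instance Definition _ :=
  GRing.isNmodule.Build (extended G) ext_addA ext_addC ext_add0.

Lemma finD a b : fin (a + b) = fin a + fin b. Proof. by []. Qed.

Lemma fin_le a b : (fin a <= fin b) = (a <= b). Proof. by []. Qed.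

Lemma fin_inj : injective (@fin G). Proof. by move=> a b []. Qed.

Lemma addr_top x : x + infty = infty. Proof. by case: x. Qed.

Lemma add_topr x : infty + x = infty. Proof. by []. Qed.

Lemma ext_finP x : x != infty -> exists a, x = fin a.
Proof. by case: x => [a|] // _; exists a. Qed.

Lemma ext_leD x x' y y' : x <= x' -> y <= y' -> x + y <= x' + y'.
Proof.
case: x' y' => [a'|] [b'|] //=; rewrite ?addr_top ?add_topr ?lex1 //.
case: x y => [a|] [b|] //.
rewrite -![Some _]/(fin _) -!finD !fin_le => ha hb.
apply: le_trans (oag_leD2l a hb) _.
by rewrite addrC [leRHS]addrC; apply: oag_leD2l.
Qed.

Lemma ext_le_add2r a x y : (x + fin a <= y + fin a) = (x <= y).
Proof.
apply/idP/idP => [h|h]; last exact: ext_leD.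
have := ext_leD h (lexx (fin (- a))).
by rewrite -!addrA -finD subrr !addr0.
Qed.

Lemma ext_addrI a : injective (fun x : extended G => x + fin a).
Proof.
by move=> x y h; apply/le_anti; rewrite -(ext_le_add2r a x) -(ext_le_add2r a y) h lexx.
Qed.

Lemma ext_minDr x y z : Order.min x y + z = Order.min (x + z) (y + z).
Proof.
case: z => [a|]; last by rewrite !addr_top minxx.
rewrite -[Some a]/(fin a).
case/orP: (le_total x y) => h; first by rewrite !min_l ?ext_le_add2r.
by rewrite !min_r ?ext_le_add2r.
Qed.

Fact ext_min_topx : left_id infty (Order.min : extended G -> _ -> _).
Proof. by move=> x; rewrite min_r ?lex1. Qed.

Fact ext_min_xtop : right_id infty (Order.min : extended G -> _ -> _).
Proof. by move=> x; rewrite min_l ?lex1. Qed.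

HB.instance Definition _ := Monoid.isMonoidLaw.Build (extended G) infty
  (Order.min : extended G -> _ -> _) ext_min_topx ext_min_xtop.

End Extended.

(* The support, i.e. the preimage of infinity, need not be zero here. *)
Record valuation (R : comNzRingType) (G : orderedGroupType) := Valuation {
  valuation_fun :> R -> extended G;
  valM : forall f g, valuation_fun (f * g) = valuation_fun f + valuation_fun g;
  valD : forall f g,
    Order.min (valuation_fun f) (valuation_fun g) <= valuation_fun (f + g);
  val1 : valuation_fun 1 = fin 0;
  val0 : valuation_fun 0 = infty
}.

Definition zero_support (R : comNzRingType) (G : orderedGroupType)
    (v : valuation R G) :=
  forall f, v f = infty -> f = 0.

Section ValuationTheory.
Variables (R : comNzRingType) (G : orderedGroupType) (v : valuation R G).

Lemma valN f : v (- f) = v f.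
Proof.
suff valN1 : v (- 1) = fin 0 by rewrite -mulN1r valM valN1 add0r.
have: v (- 1) + v (- 1) = fin 0 by rewrite -valM mulrNN mulr1 val1.
case: (v (- 1)) => [a|] //; rewrite -![Some _]/(fin _) -finD => /fin_inj aa.
congr fin; apply/le_anti.
by case/orP: (oag_le_total a 0) => a0; have := oag_leD2l a a0;
   rewrite aa addr0 => ->; rewrite a0.
Qed.

Lemma valB f g : Order.min (v f) (v g) <= v (f - g).
Proof. by rewrite -(valN g) valD. Qed.

End ValuationTheory.

Section Restriction.
Variables (R S : comNzRingType) (G : orderedGroupType).
Variables (iota : {rmorphism R -> S}) (v : valuation S G).

Fact restrM f g : v (iota (f * g)) = v (iota f) + v (iota g).
Proof. by rewrite rmorphM valM. Qed.
Fact restrD f g : Order.min (v (iota f)) (v (iota g)) <= v (iota (f + g)).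
Proof. by rewrite rmorphD valD. Qed.
Fact restr1 : v (iota 1) = fin 0.
Proof. by rewrite rmorph1 val1. Qed.
Fact restr0 : v (iota 0) = infty.
Proof. by rewrite rmorph0 val0. Qed.

Definition restriction : valuation R G := Valuation restrM restrD restr1 restr0.

End Restriction.

Section FractionValuation.
Variables (R : idomainType) (G : orderedGroupType) (v : valuation R G).
Hypothesis v_supp : zero_support v.

Definition ext_sub (x y : extended G) : extended G :=
  match x, y with
  | Some a, Some b => Some (a - b)
  | _, _ => None
  end.

Definition frac_val (r : {fraction R}) : extended G :=
  ext_sub (v \n_(repr r)) (v \d_(repr r)).

Lemma val_finP d : d != 0 -> exists a, v d = fin a.
Proof.
by move=> d0; apply: ext_finP; apply: contra_neq d0; apply: v_supp.
Qed.

Lemma ext_subK x a : ext_sub x (fin a) + fin a = x.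
Proof. by case: x => [b|] //=; rewrite -finD subrK. Qed.

Lemma frac_reprE (r : {fraction R}) :
  r * (FracField.tofrac \d_(repr r)) = FracField.tofrac \n_(repr r).
Proof.
rewrite -{1}(reprK r); unlock FracField.tofrac.
rewrite -[LHS]FracField.pi_mul; apply/eqP.
rewrite FracField.equivf_def /FracField.mulf !numden_Ratio ?mulf_neq0
  ?oner_neq0 ?denom_ratioP //.
by rewrite !mulr1 mulrC.
Qed.

Lemma frac_valE (r : {fraction R}) (n d : R) :
    d != 0 -> r * FracField.tofrac d = FracField.tofrac n ->
  frac_val r + v d = v n.
Proof.
move=> d0 rd; rewrite /frac_val.
have := frac_reprE r; set n' := \n_(repr r); set d' := \d_(repr r) => rd'.
have [a' va'] := val_finP (denom_ratioP (repr r) : d' != 0).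
rewrite va'; apply: (@ext_addrI _ a').
rewrite addrAC ext_subK -va' -!valM; congr (v _).
apply/eqP; rewrite -tofrac_eq !tofracM -rd -rd'; apply/eqP.
by rewrite -!mulrA [X in _ * X]mulrC.
Qed.

Lemma frac_val_tofrac f : frac_val (FracField.tofrac f) = v f.
Proof.
have := @frac_valE (FracField.tofrac f) f 1 (oner_neq0 _).
by rewrite tofrac1 mulr1 val1 addr0 => ->.
Qed.

Fact frac_valM r s : frac_val (r * s) = frac_val r + frac_val s.
Proof.
have hr := frac_reprE r; have hs := frac_reprE s.
have dr := denom_ratioP (repr r); have ds := denom_ratioP (repr s).
have [a va] := val_finP dr; have [b vb] := val_finP ds.
apply: (@ext_addrI _ (a + b)); rewrite finD -va -vb -valM.
rewrite (@frac_valE _ (\n_(repr r) * \n_(repr s))) ?mulf_neq0 //; last first.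
  by rewrite !tofracM mulrACA hr hs.
rewrite !valM -(@frac_valE r _ _ dr hr) -(@frac_valE s _ _ ds hs).
by rewrite addrACA.
Qed.

Fact frac_valD r s :
  Order.min (frac_val r) (frac_val s) <= frac_val (r + s).
Proof.
have hr := frac_reprE r; have hs := frac_reprE s.
have dr := denom_ratioP (repr r); have ds := denom_ratioP (repr s).
have dd : \d_(repr r) * \d_(repr s) != 0 by rewrite mulf_neq0.
have [a va] := val_finP dd.
rewrite -(ext_le_add2r a) -va ext_minDr.
rewrite (@frac_valE r (\n_(repr r) * \d_(repr s))) //; last first.
  by rewrite !tofracM mulrA hr.
rewrite (@frac_valE s (\n_(repr s) * \d_(repr r))) //; last first.
  by rewrite !tofracM mulrCA mulrC hs.
rewrite (@frac_valE (r + s)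
  (\n_(repr r) * \d_(repr s) + \n_(repr s) * \d_(repr r))) ?valD //.
by rewrite tofracD !tofracM -hr -hs mulrDl mulrA; congr (_ + _);
   rewrite mulrCA mulrC.
Qed.

Fact frac_val1 : frac_val 1 = fin 0.
Proof. by rewrite -tofrac1 frac_val_tofrac val1. Qed.

Fact frac_val0 : frac_val 0 = infty.
Proof. by rewrite -tofrac0 frac_val_tofrac val0. Qed.

Definition frac_valuation : valuation {fraction R} G :=
  Valuation frac_valM frac_valD frac_val1 frac_val0.

Lemma frac_valuation_unique (w : valuation {fraction R} G) :
  (forall f, w (FracField.tofrac f) = v f) -> w =1 frac_valuation.
Proof.
move=> wv r; have [a va] := val_finP (denom_ratioP (repr r)).
apply: (@ext_addrI _ a); rewrite -va /= (frac_valE (denom_ratioP _) (frac_reprE r)).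
by rewrite -!wv -valM frac_reprE.
Qed.

End FractionValuation.

Definition value_group (F : fieldType) (G : orderedGroupType)
    (v : valuation F G) (a : G) : Prop :=
  exists x : F, v x = fin a.

Section ResidueField.
Variables (F : fieldType) (G : orderedGroupType) (v : valuation F G).

Definition valring_pred : {pred F} := fun x => fin 0 <= v x.

Fact valring_subring_closed : subring_closed valring_pred.
Proof.
split=> [|x y|x y]; rewrite /in_mem /= /valring_pred ?val1 // => hx hy.
  by apply: le_trans (valB _ _ _); rewrite le_min hx.
by rewrite valM -[fin 0]addr0; apply: ext_leD.
Qed.

HB.instance Definition _ :=
  GRing.isSubringClosed.Build F valring_pred valring_subring_closed.

Record valring := ValRing { valring_val :> F; _ : valring_val \in valring_pred }.

HB.instance Definition _ := [isSub for valring_val].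
HB.instance Definition _ := [Choice of valring by <:].
HB.instance Definition _ := [SubChoice_isSubComNzRing of valring by <:].

Definition maxideal : {pred valring} := fun x => fin 0 < v (val x).

Fact maxideal_idealr_closed : idealr_closed maxideal.
Proof.
split=> [||a x y]; rewrite /in_mem /= /maxideal.
- by rewrite rmorph0 val0.
- by rewrite rmorph1 val1 ltxx.
move=> hx hy; rewrite rmorphD rmorphM; apply: lt_le_trans (valD _ _ _).
rewrite lt_min hy andbT valM; apply: (lt_le_trans hx).
by rewrite -[leLHS]add0r; apply: ext_leD => //; apply: (valP a).
Qed.

HB.instance Definition _ :=
  isIdealr.Build valring maxideal maxideal_idealr_closed.

Definition residue := {ideal_quot maxideal}.

HB.instance Definition _ := GRing.ComNzRing.on residue.
HB.instance Definition _ := EqQuotient.on residue.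

Definition residue_class (x : valring) : residue := \pi_residue x.

Lemma residue_classE x y :
  (residue_class x == residue_class y) = (fin 0 < v (val x - val y)).
Proof. by rewrite -Quotient.idealrBE /in_mem /= /maxideal rmorphB. Qed.

Fact residue_class_is_zmod_morphism : zmod_morphism residue_class.
Proof. exact: rmorphB. Qed.
Fact residue_class_is_monoid_morphism : monoid_morphism residue_class.
Proof. by split; [exact: rmorph1 | exact: rmorphM]. Qed.

HB.instance Definition _ := GRing.isZmodMorphism.Build valring residue
  residue_class residue_class_is_zmod_morphism.
HB.instance Definition _ := GRing.isMonoidMorphism.Build valring residue
  residue_class residue_class_is_monoid_morphism.

Lemma residue_classK (x : residue) : residue_class (repr x) = x.
Proof. exact: reprK. Qed.

Lemma residue_class_eq0 x : (residue_class x == 0) = (fin 0 < v (val x)).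
Proof. by rewrite -(rmorph0 residue_class) residue_classE rmorph0 subr0. Qed.

Definition residue_inv (x : residue) : residue :=
  if x == 0 then 0 else residue_class (insubd 0 (val (repr x))^-1).

Fact residue_mulVf (x : residue) : x != 0 -> residue_inv x * x = 1.
Proof.
move=> x0; rewrite /residue_inv (negPf x0) -{2}(residue_classK x) -rmorphM.
rewrite -(rmorph1 residue_class); congr residue_class; apply: val_inj => /=.
move: x0; rewrite -{1}(residue_classK x) residue_class_eq0 -leNgt.
case: (repr x) => y /= _ vy.
have y0 : y != 0 by apply: contraTneq vy => ->; rewrite val0.
rewrite insubdK ?mulVf // /in_mem /= /valring_pred.
rewrite -(val1 v) -(mulVf y0) valM.
by rewrite -[leRHS]addr0; apply: ext_leD.
Qed.

Fact residue_inv0 : residue_inv 0 = 0.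
Proof. by rewrite /residue_inv eqxx. Qed.

HB.instance Definition _ :=
  GRing.ComNzRing_isField.Build residue residue_mulVf residue_inv0.

End ResidueField.

Section ResidueMap.
Variables (F E : fieldType) (G : orderedGroupType) (iota : {rmorphism F -> E}).
Variables (v : valuation F G) (w : valuation E G).
Hypothesis iota_val : forall x, w (iota x) = v x.

Fact valring_map_subproof (x : valring v) : iota (val x) \in valring_pred w.
Proof. by rewrite /in_mem /= /valring_pred iota_val; apply: (valP x). Qed.

Definition valring_map (x : valring v) : valring w :=
  ValRing (valring_map_subproof x).

Definition residue_map (x : residue v) : residue w :=
  residue_class (valring_map (repr x)).

Lemma residue_mapE x : residue_map (residue_class x) = residue_class (valring_map x).
Proof.
apply/eqP; rewrite /residue_map residue_classE /= -rmorphB iota_val.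
by rewrite -residue_classE residue_classK.
Qed.

Fact residue_map_is_zmod_morphism : zmod_morphism residue_map.
Proof.
move=> x y; rewrite -(residue_classK x) -(residue_classK y) -rmorphB.
rewrite !residue_mapE -rmorphB; congr residue_class.
by apply: val_inj; rewrite /= rmorphB.
Qed.

Fact residue_map_is_monoid_morphism : monoid_morphism residue_map.
Proof.
split=> [|x y].
  rewrite -(rmorph1 (@residue_class _ _ v)) residue_mapE.
  rewrite -(rmorph1 (@residue_class _ _ w)); congr residue_class.
  by apply: val_inj; rewrite /= rmorph1.
rewrite -(residue_classK x) -(residue_classK y) -rmorphM.
rewrite !residue_mapE -rmorphM; congr residue_class.
by apply: val_inj; rewrite /= rmorphM.
Qed.

HB.instance Definition _ := GRing.isZmodMorphism.Build (residue v) (residue w)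
  residue_map residue_map_is_zmod_morphism.
HB.instance Definition _ := GRing.isMonoidMorphism.Build (residue v) (residue w)
  residue_map residue_map_is_monoid_morphism.

End ResidueMap.

(* The quotient A / B is a torsion group, for subgroups B of A. *)
Definition torsion_quotient (G : zmodType) (A B : G -> Prop) :=
  forall a, A a -> exists2 n, (0 < n)%N & B (a *+ n).

Section ValuationPoly.
Variables (K : fieldType) (G : orderedGroupType) (nu : valuation {poly K} G).
Implicit Types (p q : {poly K}) (s : seq {poly K}) (i n : nat).

Definition nuK : valuation K G := restriction polyC nu.

Section Kinds.
Hypothesis nu_supp : zero_support nu.

Definition nuKx : valuation {fraction {poly K}} G := frac_valuation nu_supp.

Definition K_to_Kx : K -> {fraction {poly K}} :=
  @FracField.tofrac {poly K} \o polyC.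

HB.instance Definition _ := GRing.RMorphism.on K_to_Kx.

Fact K_to_Kx_val x : nuKx (K_to_Kx x) = nuK x.
Proof. exact: frac_val_tofrac. Qed.

Definition valuation_algebraic : Prop :=
  torsion_quotient (value_group nuKx) (value_group nuK) /\
  forall z : residue nuKx, algebraicOver (residue_map K_to_Kx_val) z.

Definition valuation_transcendental : Prop := ~ valuation_algebraic.

End Kinds.

Definition qcoef (q p : {poly K}) (i : nat) : {poly K} := (p %/ q ^+ i) %% q.

Definition is_qexpansion (q p : {poly K}) (s : seq {poly K}) :=
  p = \sum_(i < size s) s`_i * q ^+ i /\
  forall i : 'I_(size s), (size (s`_i)%R < size q)%N.

Lemma is_qexpansion_coef q p s i : (1 < size q)%N ->
  is_qexpansion q p s -> s`_i = qcoef q p i.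
Proof.
move=> q1 [pE sq].
have q0 : q != 0 by rewrite -size_poly_gt0 (ltn_trans _ q1).
elim: s p i pE sq => [|c s IHs] p i pE sq.
  by rewrite pE big_ord0 nth_nil /qcoef div0p mod0p.
have cq : (size c < size q)%N := sq ord0.
set t := \sum_(i < size s) s`_i * q ^+ i.
have {}pE : p = t * q + c.
  rewrite pE big_ord_recl /= expr0 mulr1 addrC; congr (_ + _).
  rewrite /t mulr_suml; apply: eq_bigr => j _.
  by rewrite /= /bump /= add1n exprSr mulrA.
case: i => [|i] /=.
  by rewrite /qcoef expr0 divp1 pE modp_addl_mul_small.
rewrite (IHs t i erefl (fun j => sq (lift ord0 j))) /qcoef.
by rewrite exprS -divp_divl pE divp_addl_mul_small.
Qed.

Lemma qexpansion_exists q p : (1 < size q)%N ->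
  is_qexpansion q p (mkseq (qcoef q p) (size p)).
Proof.
move=> q1; have q0 : q != 0 by rewrite -size_poly_gt0 (ltn_trans _ q1).
split=> [|i]; last first.
  by rewrite nth_mkseq ?ltn_modp //; have := ltn_ord i; rewrite {2}size_mkseq.
suff H n : p = \sum_(i < n) qcoef q p i * q ^+ i + (p %/ q ^+ n) * q ^+ n.
  rewrite {1}(H (size p)) divp_small ?mul0r ?addr0; last first.
    case: (p =P 0) => [->|/eqP p0].
      by rewrite size_poly0 size_poly_gt0 expf_neq0.
    have -> : size (q ^+ size p) = ((size q).-1 * size p).+1.
      by rewrite -size_exp prednK // size_poly_gt0 expf_neq0.
    by rewrite ltnS leq_pmull // -ltnS prednK // (ltn_trans _ q1).
  rewrite size_mkseq; apply: eq_bigr => i _; by rewrite nth_mkseq.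
elim: n => [|n IHn]; first by rewrite big_ord0 add0r expr0 divp1 mulr1.
rewrite {1}IHn big_ord_recr /= -addrA; congr (_ + _).
rewrite {1}(divp_eq (p %/ q ^+ n) q) divp_divl -exprSr mulrDl addrC.
by rewrite -mulrA -exprS.
Qed.

(* For q nonconstant, the q-expansion of p has at most [size p] terms; the
   remaining indices contribute the value infinity. *)
Definition truncation (q p : {poly K}) : extended G :=
  \big[Order.min/infty]_(i < size p) nu (qcoef q p i * q ^+ i).

Lemma truncationE q p s : (1 < size q)%N -> is_qexpansion q p s ->
  truncation q p = \big[Order.min/infty]_(i < size s) nu (s`_i * q ^+ i).
Proof.
move=> q1 ps.
pose f i := nu (qcoef q p i * q ^+ i).
have f_top s' : is_qexpansion q p s' -> forall i, (size s' <= i)%N -> f i = infty.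
  move=> ps' i le_s'i; rewrite /f -(is_qexpansion_coef i q1 ps').
  by rewrite nth_default // mul0r val0.
have widen m k : (forall i, (m <= i)%N -> f i = infty) ->
    \big[Order.min/infty]_(i < m + k) f i = \big[Order.min/infty]_(i < m) f i.
  move=> fm; rewrite big_split_ord /= [X in Order.min _ X]big1 ?Monoid.mulm1 //.
  by move=> i _; rewrite fm ?leq_addr.
have := widen _ (size s) (f_top _ (qexpansion_exists p q1)).
have := widen _ (size p) (f_top _ ps).
rewrite size_mkseq addnC => -> E.
rewrite /truncation -[LHS]E; apply: eq_bigr => i _.
by rewrite (is_qexpansion_coef i q1 ps).
Qed.

End ValuationPoly.

(* Main.v *)
From mathcomp Require Import all_boot all_order all_algebra.
From mathcomp Require Import ring.
From Stdlib Require Import Classical.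
Require Import Defs.

(** Write w for the extension of nu to K(x), and call z in K(x) algebraic if
    z^n b is, for some n > 0 and b in K, a w-unit whose residue is algebraic
    over the residue field of K.  This single condition says both that w(z) is
    torsion modulo the value group of K and that the residues to which z gives
    rise are algebraic.  Since algebraic elements of the residue field form a
    field, the algebraic z form a subgroup of K(x)^*, closed under taking
    roots, and nu is valuation-algebraic exactly when this subgroup contains
    every nonzero polynomial ([valuation_algebraicP]).  Working with it treats
    the two ways of being transcendental (value group, residue field) at once.

    The heart of the proof is [val_sum_transcendental]: if t is not algebraic
    and every nonzero a_i is, then the value of sum_i a_i t^i is the minimum of
    the values of its terms.  Otherwise the terms of minimal value cancel in
    the residue field.  Divide by the one of least index and let e be the least
    positive exponent for which some c t^e with c algebraic is a unit; all exponents of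
    the surviving terms are then multiples of e, so that the cancellation is a
    polynomial equation for the residue of u = c t^e with algebraic
    coefficients.  Hence u is algebraic, and so are t^e = u / c and t.

    If nu is transcendental, take for q a polynomial of least degree among the
    nonzero non-algebraic ones.  Its expansions have algebraic or zero
    coefficients, and the previous result says that nu = nu_q.

    Conversely let nu = nu_q.  If q were algebraic, some y = q^n b would be a
    unit whose residue is a root of a nonzero polynomial P.  Lifting the coefficients of P to
    elements a_i of K gives sum_i a_i y^i of positive value.  But this is a
    q-expansion with constant coefficients, so that its value is at most that
    of each a_j y^j, which is 0 as soon as P_j is nonzero: a contradiction. *)

Set Implicit Arguments.
Unset Strict Implicit.
Unset Printing Implicit Defensive.

Import Order.TTheory GRing.Theory.
Local Open Scope ring_scope.

(** * Preliminaries *)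

Lemma least_nat (P : nat -> Prop) :
  (exists n, P n) -> exists2 n, P n & forall m, P m -> (n <= m)%N.
Proof.
move=> [n Pn]; apply: NNPP => noleast.
suff nP k m : (m < k)%N -> ~ P m by exact: nP n.+1 n (ltnSn n) Pn.
elim: k m => // k IHk m; rewrite ltnS => le_mk Pm.
apply: noleast; exists m => // l Pl; rewrite leqNgt; apply/negP => lt_lm.
exact: IHk l (leq_trans lt_lm le_mk) Pl.
Qed.

(** The polynomial is given as a sum of monomials, with possibly repeated
    exponents, because this is how the residue relation below presents it. *)
Lemma algebraic_root_sum (F E : fieldType) (f : {rmorphism F -> E})
    (I : finType) (S : pred I) (c : I -> E) (d : I -> nat) (x : E) :
    \sum_(i | S i) c i *: 'X^(d i) != 0 ->
    root (\sum_(i | S i) c i *: 'X^(d i)) x ->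
  (forall i, S i -> algebraicOver f (c i)) -> algebraicOver f x.
Proof.
move=> q_neq0 q_root alg_c; apply/integral_algebraic.
apply: (integral_root q_neq0 q_root); apply/integral_poly => k.
rewrite coef_sum; apply: (big_ind (integralOver f)) => [|y z|i Si].
- exact: integral0.
- exact: integral_add.
rewrite coefZ coefXn; apply: integral_mul; last exact: integral_nat.
exact/integral_algebraic/alg_c.
Qed.

Lemma finMn (G : orderedGroupType) (a : G) n : fin a *+ n = fin (a *+ n).
Proof. by elim: n => // n IHn; rewrite !mulrS IHn -finD. Qed.

Lemma fraction_quotient (R : idomainType) (z : {fraction R}) : exists n d,
  d != 0 /\ z = FracField.tofrac n / FracField.tofrac d.
Proof.
exists \n_(repr z), \d_(repr z); split; first exact: denom_ratioP.
by rewrite -frac_reprE mulfK // tofrac_eq0 denom_ratioP.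
Qed.

Section ValuationFacts.
Variables (R : comNzRingType) (G : orderedGroupType) (w : valuation R G).

Lemma valX z n : w (z ^+ n) = w z *+ n.
Proof.
elim: n => [|n IHn]; first by rewrite expr0 val1 mulr0n.
by rewrite exprS valM IHn mulrS.
Qed.

Lemma valX_unit z n : w z = fin 0 -> w (z ^+ n) = fin 0.
Proof. by move=> wz; rewrite valX wz mul0rn. Qed.

Lemma val_sum_ge (m : extended G) n (f : 'I_n -> R) :
  (forall i, m <= w (f i)) -> m <= w (\sum_i f i).
Proof.
move=> mf; apply: (big_ind (fun s => m <= w s)) => [|x y mx my|i _] //.
  by rewrite val0 lex1.
by apply: le_trans (valD w x y); rewrite le_min mx.
Qed.

Lemma val_sum_gt a n (f : 'I_n -> R) :
  (forall i, fin a < w (f i)) -> fin a < w (\sum_i f i).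
Proof.
move=> mf; apply: (big_ind (fun s => fin a < w s)) => [|x y mx my|i _] //.
  by rewrite val0.
by apply: lt_le_trans (valD w x y); rewrite lt_min mx.
Qed.

End ValuationFacts.

(** * Residues of elements of a valued field *)

Section FieldValuation.
Variables (F : fieldType) (G : orderedGroupType) (w : valuation F G).

Lemma val_fin_neq0 z a : w z = fin a -> z != 0.
Proof. by apply: contra_eq_neq => ->; rewrite val0. Qed.

Lemma val_neq0_fin z : z != 0 -> exists a, w z = fin a.
Proof.
move=> z0; have : w z + w z^-1 = fin 0 by rewrite -valM mulfV ?val1.
by case: (w z) => // a _; exists a.
Qed.

Lemma valV z a : w z = fin a -> w z^-1 = fin (- a).
Proof.
move=> wz; apply: (@ext_addrI _ a).
by rewrite -wz -valM mulVf ?(val_fin_neq0 wz) // val1 wz -finD addNr.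
Qed.

Lemma valV_unit z : w z = fin 0 -> w z^-1 = fin 0.
Proof. by move/valV->; rewrite oppr0. Qed.

(** The residue as a total function, with value 0 outside the valuation ring,
    so that integrality proofs stay out of the computations. *)
Definition residue_of (u : F) : residue w := residue_class (insubd 0 u).

Lemma residue_ofE u (u_int : u \in valring_pred w) :
  residue_of u = residue_class (ValRing u_int).
Proof.
by rewrite /residue_of; congr residue_class; apply: val_inj; rewrite insubdK.
Qed.

Lemma residue_of_val (u : valring w) : residue_of (val u) = residue_class u.
Proof. by rewrite /residue_of valKd. Qed.

Lemma residue_of1 : residue_of 1 = 1.
Proof. exact: etrans (residue_of_val 1) (rmorph1 _). Qed.

Lemma residue_ofM u1 u2 : fin 0 <= w u1 -> fin 0 <= w u2 ->
  residue_of (u1 * u2) = residue_of u1 * residue_of u2.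
Proof.
move=> u1_int u2_int; rewrite (residue_ofE u1_int) (residue_ofE u2_int).
exact: etrans (residue_of_val (ValRing u1_int * ValRing u2_int)) (rmorphM _ _ _).
Qed.

Lemma residue_ofX u n : fin 0 <= w u ->
  residue_of (u ^+ n) = residue_of u ^+ n.
Proof.
move=> u_int; rewrite (residue_ofE u_int) -rmorphXn -[RHS]residue_of_val.
by rewrite rmorphXn.
Qed.

Lemma residue_of_sum n (f : 'I_n -> F) : (forall i, fin 0 <= w (f i)) ->
  residue_of (\sum_i f i) = \sum_i residue_of (f i).
Proof.
move=> f_int; pose g i : valring w := ValRing (f_int i).
rewrite (eq_bigr (fun i => val (g i))) // -rmorph_sum residue_of_val rmorph_sum.
by apply: eq_bigr => i _; apply/esym/(residue_of_val (g i)).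
Qed.

Lemma residue_of_eq0 u : fin 0 <= w u -> (residue_of u == 0) = (fin 0 < w u).
Proof. by move=> u_int; rewrite (residue_ofE u_int) residue_class_eq0. Qed.

Lemma residue_ofV u : w u = fin 0 -> residue_of u^-1 = (residue_of u)^-1.
Proof.
move=> wu; have := residue_of_eq0 (_ : fin 0 <= w u).
rewrite wu lexx ltxx => /(_ isT) /negbT ru0.
apply: (mulfI ru0); rewrite -residue_ofM ?valV_unit ?wu ?lexx //.
by rewrite !mulfV ?residue_of1 ?(val_fin_neq0 wu).
Qed.

End FieldValuation.

(** * The group of algebraic elements *)

Section AlgebraicElements.
Variables (F E : fieldType) (G : orderedGroupType) (iota : {rmorphism F -> E}).
Variables (v : valuation F G) (w : valuation E G).
Hypothesis iota_val : forall x, w (iota x) = v x.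
Implicit Types (z t : E) (b : F).

(** An inductive wrapper rather than a definition: failed comparisons of two
    such statements would otherwise unfold the quotient ring operations. *)
Variant residue_alg z : Prop :=
  ResidueAlg of algebraicOver (residue_map iota_val) (residue_of w z).

Lemma residue_algE z r : residue_of w z = r ->
  residue_alg z <-> algebraicOver (residue_map iota_val) r.
Proof. by move=> <-; split=> [[] | alg]. Qed.

(** For z != 0, this is the conjunction of w(z) being torsion modulo the value
    group of F and of the residue of any unit z^n b being algebraic; no
    witness exists for z = 0. *)
Definition val_algebraic z := exists n b,
  [/\ (0 < n)%N, w (z ^+ n * iota b) = fin 0 & residue_alg (z ^+ n * iota b)].

Lemma residue_of_iota b : fin 0 <= v b ->
  residue_of w (iota b) = residue_map iota_val (residue_of v b).
Proof.
move=> b_int; rewrite (residue_ofE b_int) residue_mapE.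
by rewrite -residue_of_val.
Qed.

(** A polynomial over the residue field is evaluated by lifting its
    coefficients to the valuation ring of F. *)
Lemma residue_of_horner (P : {poly residue v}) z : fin 0 <= w z ->
  residue_of w (\sum_(i < size P) iota (val (repr P`_i)) * z ^+ i) =
  (map_poly (residue_map iota_val) P).[residue_of w z].
Proof.
move=> z_int.
have zX_int i : fin 0 <= w (z ^+ i).
  elim: i => [|i IHi]; first by rewrite expr0 val1 lexx.
  by rewrite exprS valM -[fin 0]addr0; apply: ext_leD.
have lift_int i : fin 0 <= v (val (repr P`_i)) by apply: (valP (repr P`_i)).
have iota_int i : fin 0 <= w (iota (val (repr P`_i))) by rewrite iota_val.
rewrite residue_of_sum => [|i]; last first.
  by rewrite valM -[fin 0]addr0; apply: ext_leD.
have szP : (size (map_poly (residue_map iota_val) P) <= size P)%N.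
  by rewrite size_map_poly.
rewrite (horner_coef_wide _ szP); apply: eq_bigr => i _.
rewrite coef_map residue_ofM // residue_of_iota // residue_ofX //.
by rewrite residue_of_val residue_classK.
Qed.

Lemma residue_alg_iota b : fin 0 <= v b -> residue_alg (iota b).
Proof.
by move=> b_int; apply/(residue_algE (residue_of_iota b_int))/algebraic_id.
Qed.

Lemma residue_alg1 : residue_alg 1.
Proof. exact/(residue_algE (residue_of1 w))/algebraic1. Qed.

Lemma residue_algM z1 z2 : w z1 = fin 0 -> w z2 = fin 0 ->
  residue_alg z1 -> residue_alg z2 -> residue_alg (z1 * z2).
Proof.
move=> wz1 wz2 [alg1] [alg2].
have resM : residue_of w (z1 * z2) = residue_of w z1 * residue_of w z2.
  by rewrite residue_ofM ?wz1 ?wz2.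
exact/(residue_algE resM)/(algebraic_mul alg1 alg2).
Qed.

Lemma residue_algV z : w z = fin 0 -> residue_alg z -> residue_alg z^-1.
Proof.
by move=> wz [alg]; apply/(residue_algE (residue_ofV wz))/(algebraic_inv alg).
Qed.

Lemma residue_algX z n : w z = fin 0 -> residue_alg z -> residue_alg (z ^+ n).
Proof.
move=> wz alg; elim: n => [|n IHn]; first by rewrite expr0; apply: residue_alg1.
by rewrite exprS; apply: residue_algM; rewrite ?valX_unit.
Qed.

Lemma residue_alg_root z n : (0 < n)%N -> w z = fin 0 ->
  residue_alg (z ^+ n) -> residue_alg z.
Proof.
move=> n0 wz [alg]; apply: ResidueAlg; apply/integral_algebraic.
pose p := 'X^n - (residue_of w (z ^+ n))%:P.
have p_monic : p \is monic by apply: monicXnsubC.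
have p_root : root p (residue_of w z).
  by rewrite /root !hornerE residue_ofX ?wz // subrr.
apply: (integral_root_monic p_monic p_root).
apply/integral_poly => i; rewrite coefB coefXn coefC.
apply: integral_sub; first exact: integral_nat.
by case: ifP => _; [apply/integral_algebraic | apply: integral0].
Qed.

Lemma val_algebraic_neq0 z : val_algebraic z -> z != 0.
Proof.
case=> n [b [n0 wz _]]; apply: contra_eq_neq wz => ->.
by rewrite expr0n eqn0Ngt n0 mul0r val0.
Qed.

(** For a unit z, a witness z^n b forces b to be a unit of F; the residue of z
    is then an n-th root of an algebraic element. *)
Lemma val_algebraic_unit z :
  w z = fin 0 -> val_algebraic z <-> residue_alg z.
Proof.
move=> wz; split=> [[n [b [n0]]]|alg]; last first.
  by exists 1%N, 1; rewrite expr1 rmorph1 mulr1.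
rewrite valM valX_unit // add0r iota_val => vb alg.
apply: (residue_alg_root n0) => //.
have b0 : iota b != 0 by rewrite (val_fin_neq0 (w := w) (a := 0)) ?iota_val.
rewrite -(mulfK b0 (z ^+ n)); apply: residue_algM => //.
- by rewrite valM valX_unit // add0r iota_val.
- by rewrite valV_unit ?iota_val.
- by rewrite -fmorphV; apply: residue_alg_iota; rewrite valV_unit.
Qed.

Lemma val_algebraic_iota b : b != 0 -> val_algebraic (iota b).
Proof.
move=> b0; exists 1%N, b^-1; rewrite expr1 -rmorphM mulfV // rmorph1 val1.
by split=> //; apply: residue_alg1.
Qed.

Lemma val_algebraicM z1 z2 :
  val_algebraic z1 -> val_algebraic z2 -> val_algebraic (z1 * z2).
Proof.
move=> [n1 [b1 [n1_gt0 wz1 alg1]]] [n2 [b2 [n2_gt0 wz2 alg2]]].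
exists (n1 * n2)%N, (b1 ^+ n2 * b2 ^+ n1).
have -> : (z1 * z2) ^+ (n1 * n2) * iota (b1 ^+ n2 * b2 ^+ n1) =
          (z1 ^+ n1 * iota b1) ^+ n2 * (z2 ^+ n2 * iota b2) ^+ n1.
  rewrite rmorphM !rmorphXn !exprMn -!exprM (mulnC n2 n1).
  by rewrite mulrACA.
rewrite muln_gt0 n1_gt0 valM !valX_unit ?addr0 //; split=> //.
by apply: residue_algM; rewrite ?valX_unit //; apply: residue_algX.
Qed.

Lemma val_algebraicV z : val_algebraic z -> val_algebraic z^-1.
Proof.
move=> [n [b [n0 wz alg]]]; exists n, b^-1.
rewrite fmorphV exprVn -invfM; split=> //; first by rewrite valV_unit.
exact: residue_algV.
Qed.

Lemma val_algebraic1 : val_algebraic 1.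
Proof.
by rewrite -(rmorph1 iota); apply: val_algebraic_iota; apply: oner_neq0.
Qed.

Lemma val_algebraicX z n : val_algebraic z -> val_algebraic (z ^+ n).
Proof.
move=> az; elim: n => [|n IHn]; first exact: val_algebraic1.
by rewrite exprS; apply: val_algebraicM.
Qed.

Lemma val_algebraic_root z n :
  (0 < n)%N -> val_algebraic (z ^+ n) -> val_algebraic z.
Proof.
move=> n0 [m [b [m0 wz alg]]]; exists (n * m)%N, b.
by rewrite exprM muln_gt0 n0.
Qed.

(** A cancellation among residues yields an algebraic equation.  Only the terms
    of value 0 survive in the residue field.  If e is the least positive
    exponent for which t^e is, up to an algebraic factor c, a unit u, division
    with remainder shows that t occurs in the surviving terms with exponents
    divisible by e, so that these terms are g_i u^(i/e) with g_i an algebraic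
    unit. *)
Lemma val_algebraic_relation t n (a : nat -> E) :
    a 0%N = 1 -> (forall i, (i <= n)%N -> a i = 0 \/ val_algebraic (a i)) ->
    (forall i, (i <= n)%N -> fin 0 <= w (a i * t ^+ i)) ->
    fin 0 < w (\sum_(i < n.+1) a i * t ^+ i) ->
  val_algebraic t.
Proof.
move=> a0 alg_a int_a sum_gt0.
pose S i := w (a i * t ^+ i) == fin 0.
have alg_S i : (i <= n)%N -> S i -> val_algebraic (a i).
  move=> le_in Si; case: (alg_a i le_in) => // ai0.
  by move: Si; rewrite /S ai0 mul0r val0.
have S0 : S 0%N by rewrite /S a0 expr0 mulr1 val1.
have res_sum : \sum_(i < n.+1) residue_of w (a i * t ^+ i) = 0.
  have int_ai (i : 'I_n.+1) : fin 0 <= w (a i * t ^+ i).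
    by apply: int_a; rewrite -ltnS.
  apply/eqP; rewrite -residue_of_sum // residue_of_eq0 //.
  exact: ltW.
have res_S i : (i <= n)%N -> ~~ S i -> residue_of w (a i * t ^+ i) = 0.
  move=> le_in nSi; apply/eqP; rewrite residue_of_eq0 ?int_a //.
  by rewrite lt_neqAle eq_sym nSi int_a.
pose P r := (0 < r)%N /\ exists2 c, val_algebraic c & w (c * t ^+ r) = fin 0.
(* Without such an exponent the constant term 1 is the only survivor, and it
   cannot cancel. *)
have [exP|noP] := classic (exists r, P r); last first.
  move: res_sum; rewrite big_ord_recl big1 => [|i _]; last first.
    apply: res_S; first by rewrite lift0.
    apply/negP => Si; apply: noP; exists (lift ord0 i); split=> //.
    by exists (a (lift ord0 i)); [apply: alg_S => //; rewrite lift0|apply/eqP].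
  rewrite /= a0 expr0 mulr1 residue_of1 addr0 => /eqP.
  by rewrite oner_eq0.
have [e [e0 [c alg_c wc]] min_e] := least_nat exP.
have c0 := val_algebraic_neq0 alg_c.
pose u := c * t ^+ e.
pose g i := a i / c ^+ (i %/ e).
have gE i : a i * t ^+ i = g i * t ^+ (i %% e) * u ^+ (i %/ e).
  rewrite /g /u exprMn -exprM.
  rewrite [X in _ * _ ^+ X = _](divn_eq i e) exprD [(_ %/ e * e)%N]mulnC.
  by field; rewrite expf_neq0.
have wu k : w (u ^+ k) = fin 0 by apply: valX_unit.
have dvd_S i : (i <= n)%N -> S i -> (e %| i)%N.
  move=> le_in Si; rewrite /dvdn -leqn0 leqNgt; apply/negP => r0.
  (* A nonzero remainder would contradict the minimality of e. *)
  suff : (e <= i %% e)%N by rewrite leqNgt ltn_mod e0.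
  apply: min_e; split=> //; exists (g i).
    by apply: val_algebraicM (alg_S i le_in Si) (val_algebraicV _);
       apply: val_algebraicX.
  by move: Si; rewrite /S gE valM wu addr0 => /eqP.
have gS i : (i <= n)%N -> S i -> a i * t ^+ i = g i * u ^+ (i %/ e).
  by move=> le_in Si; rewrite gE (eqP (dvd_S i le_in Si)) expr0 mulr1.
have wg i : (i <= n)%N -> S i -> w (g i) = fin 0.
  by move=> le_in Si; move: (Si); rewrite /S gS // valM wu addr0 => /eqP.
pose q := \sum_(i < n.+1 | S i)
  residue_of w (g i) *: 'X^(i %/ e) : {poly residue w}.
have q_root : root q (residue_of w u).
  apply/eqP; rewrite -[RHS]res_sum (bigID (fun i : 'I_n.+1 => S i)) /=.
  rewrite [X in _ = _ + X]big1 ?addr0 => [|i nSi]; last first.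
    by apply: res_S nSi; rewrite -ltnS.
  rewrite horner_sum; apply: eq_bigr => i Si.
  have le_in : (i <= n)%N by rewrite -ltnS.
  rewrite gS // hornerZ hornerXn (@residue_ofM _ _ _ (g i)) ?wu ?wg //.
  by rewrite -residue_ofX // (wu 1%N).
have q_neq0 : q != 0.
  (* As e divides every i in S, only i = 0 contributes to the constant
     coefficient. *)
  suff q0 : q`_0 = 1.
    by apply: contra_eq_neq q0 => ->; rewrite coef0 eq_sym oner_eq0.
  rewrite coef_sum big_mkcond big_ord_recl big1 /= => [|i _]; last first.
    case: ifP => // Si; rewrite coefZ coefXn.
    have le_in : (lift ord0 i <= n)%N by rewrite lift0.
    by rewrite ltn_eqF ?mulr0 // divn_gt0 // dvdn_leq // dvd_S.
  rewrite S0 /g div0n expr0 divr1 a0 residue_of1 scale1r expr0 coef1 addr0.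
  by [].
have alg_u : residue_alg u.
  apply/ResidueAlg/(algebraic_root_sum q_neq0 q_root) => i Si.
  have le_in : (i <= n)%N by rewrite -ltnS.
  suff /(val_algebraic_unit (wg i le_in Si)) [] : val_algebraic (g i) by [].
  apply: val_algebraicM (alg_S i le_in Si) (val_algebraicV _).
  exact: val_algebraicX.
apply: (val_algebraic_root e0); rewrite -(mulKf c0 (t ^+ e)).
apply: val_algebraicM; first exact: val_algebraicV.
by apply/val_algebraic_unit.
Qed.

(** Dividing by the term of least index among those of minimal value brings a
    hypothetical cancellation into the normalised form of
    [val_algebraic_relation]; the terms of smaller index have larger value and
    may be dropped from the sum. *)
Lemma val_sum_transcendental t n (a : nat -> E) (j : 'I_n) :
    ~ val_algebraic t ->
    (forall i, (i < n)%N -> a i = 0 \/ val_algebraic (a i)) ->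
  w (\sum_(i < n) a i * t ^+ i) <= w (a j * t ^+ j).
Proof.
move=> trans_t alg_a; rewrite leNgt; apply/negP => lt_j.
case: (arg_minP (fun i : 'I_n => w (a i * t ^+ i)) (erefl : xpredT j)).
move=> i1 _ min_i1.
pose S (i : 'I_n) := w (a i * t ^+ i) == w (a i1 * t ^+ i1).
case: (@arg_minnP _ i1 S (fun i => i : nat) (eqxx _)) => i0 /eqP wi0 min_i0.
have {lt_j} : w (a i0 * t ^+ i0) < w (\sum_(i < n) a i * t ^+ i).
  by apply: le_lt_trans lt_j; rewrite wi0; apply: min_i1.
have {min_i1} min_val (i : 'I_n) : w (a i0 * t ^+ i0) <= w (a i * t ^+ i).
  by rewrite wi0; apply: min_i1.
have {min_i0} lt_val (i : 'I_n) :
    (i < i0)%N -> w (a i0 * t ^+ i0) < w (a i * t ^+ i).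
  move=> lt_i; rewrite lt_neqAle min_val andbT eq_sym wi0.
  by apply/negP => /min_i0; rewrite leqNgt lt_i.
case Ei0 : (w (a i0 * t ^+ i0)) min_val lt_val => [m|]; last first.
  by move=> _ _; rewrite ltNge ext_le_top.
move=> min_val lt_val sum_gt.
rewrite -[Some m]/(fin m) in Ei0 min_val lt_val sum_gt.
have := val_fin_neq0 Ei0; rewrite mulf_eq0 negb_or => /andP[ai0 ti0].
have [k nE] : exists k, n = (i0 + k.+1)%N.
  by exists (n - i0).-1; rewrite prednK ?subn_gt0 // subnKC // ltnW.
have lt_n i : (i <= k)%N -> (i0 + i < n)%N.
  by move=> le_ik; rewrite (leq_trans _ (eq_leq (esym nE))) // ltn_add2l.
pose b i := a (i0 + i)%N / a i0.
have bE i : b i * t ^+ i = a (i0 + i)%N * t ^+ (i0 + i) / (a i0 * t ^+ i0).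
  by rewrite /b exprD; field; rewrite ai0 ti0.
have wV : w (a i0 * t ^+ i0)^-1 = fin (- m) by apply: valV.
apply: trans_t; apply: (@val_algebraic_relation _ k b).
- by rewrite /b addn0 divff.
- move=> i le_ik; rewrite /b.
  case: (alg_a (i0 + i)%N) => [|->|alg_i]; first exact: lt_n.
    by left; rewrite mul0r.
  right; apply: val_algebraicM => //; apply: val_algebraicV.
  by case: (alg_a i0) => // ai00; rewrite ai00 eqxx in ai0.
- move=> i le_ik; rewrite bE valM wV.
  rewrite -(subrr m) finD ext_le_add2r.
  exact: (min_val (Ordinal (lt_n i le_ik))).
rewrite (eq_bigr (fun i : 'I_k.+1 =>
  a (i0 + i)%N * t ^+ (i0 + i) / (a i0 * t ^+ i0))) => [|i _]; last exact: bE.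
rewrite -mulr_suml valM wV ltNge -{1}(addrN m) finD ext_le_add2r -ltNge.
have split_sum N r (f : nat -> E) : N = (r + k.+1)%N ->
    \sum_(i < k.+1) f (r + i)%N = \sum_(i < N) f i - \sum_(i < r) f i.
  by move=> ->; rewrite big_split_ord /= [X in X - _]addrC addrK.
rewrite (split_sum n i0 (fun i => a i * t ^+ i)) //.
apply: lt_le_trans (valB _ _ _); rewrite lt_min sum_gt val_sum_gt // => i.
exact: (lt_val (Ordinal (ltn_trans (ltn_ord i) (ltn_ord i0))) (ltn_ord i)).
Qed.

End AlgebraicElements.

(** * Truncations of valuations on polynomials *)

Section Polynomials.
Variables (K : fieldType) (G : orderedGroupType) (nu : valuation {poly K} G).
Implicit Types (p q f g : {poly K}).

Lemma truncation_le q p i : (1 < size q)%N ->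
  truncation nu q p <= nu (qcoef q p i * q ^+ i).
Proof.
move=> q1; have [lt_ip|le_pi] := ltnP i (size p).
  exact: (bigmin_le _ (Ordinal lt_ip)).
rewrite -(is_qexpansion_coef i q1 (qexpansion_exists p q1)).
by rewrite nth_default ?size_mkseq // mul0r val0 lex1.
Qed.

Lemma truncation_le_val q p : (1 < size q)%N -> truncation nu q p <= nu p.
Proof.
move=> q1; have [pE _] := qexpansion_exists p q1.
rewrite {2}pE; apply: val_sum_ge => i.
by rewrite (is_qexpansion_coef i q1 (qexpansion_exists p q1)) truncation_le.
Qed.

(** Polynomials in q with constant coefficients are their own q-expansions,
    since constants have degree less than that of q. *)
Lemma qcoef_comp q f i : (1 < size q)%N -> qcoef q (f \Po q) i = (f`_i)%:P.
Proof.
move=> q1; pose s := [seq c%:P | c <- f].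
have s_i j : s`_j = (f`_j)%:P.
  have [lt_jf|le_fj] := ltnP j (size f); first by rewrite (nth_map 0).
  by rewrite !nth_default ?size_map.
rewrite -s_i; apply/esym/is_qexpansion_coef => //; split=> [|j].
  rewrite comp_polyE size_map; apply: eq_bigr => j _.
  by rewrite s_i mul_polyC.
by rewrite s_i (leq_ltn_trans (size_polyC_leq1 _)).
Qed.

Hypothesis nu_supp : zero_support nu.
Local Notation w := (nuKx nu_supp).
Local Notation tofrac := (@FracField.tofrac {poly K}).
Local Notation algebraic := (val_algebraic (K_to_Kx_val nu_supp)).

(** Polynomials suffice because algebraic elements form a group and K(x)^* is
    generated by them. *)
Lemma valuation_algebraicP :
  valuation_algebraic nu_supp <-> forall p, p != 0 -> algebraic (tofrac p).
Proof.
split=> [[tors alg] p p0|alg].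
  have [a wp] : exists a, w (tofrac p) = fin a.
    by apply: val_neq0_fin; rewrite tofrac_eq0.
  have [|n n0 [c wc]] := tors a; first by exists (tofrac p).
  exists n, c^-1; split=> //.
  by rewrite valM valX wp K_to_Kx_val (valV wc) finMn -finD addrN.
have algF z : z != 0 -> algebraic z.
  have [n [d [d0 ->]]] := fraction_quotient z => nd0.
  have n0 : n != 0 by apply: contra_neq nd0 => ->; rewrite tofrac0 mul0r.
  exact: val_algebraicM (alg n n0) (val_algebraicV (alg d d0)).
split=> [a [z wz]|x].
  have [n [c [n0 wzc _]]] := algF z (val_fin_neq0 wz); exists n => //.
  exists c^-1; move: wzc; rewrite valM valX wz K_to_Kx_val.
  case vc: (nuK nu c) => [d|]; last by rewrite addr_top.
  rewrite -[Some d]/(fin d) in vc *; rewrite (valV vc) finMn -finD.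
  by move=> /fin_inj /eqP; rewrite addr_eq0 => /eqP ->.
rewrite -(residue_classK x) -residue_of_val.
have := valP (repr x); set z := val (repr x) => z_int.
have [wz|wz] := eqVneq (w z) (fin 0).
  by have /(val_algebraic_unit _ wz)[] := algF z (val_fin_neq0 wz).
have /eqP -> : residue_of w z == 0.
  by rewrite residue_of_eq0 // lt_neqAle eq_sym wz.
exact: algebraic0.
Qed.

(** A polynomial q of least degree among the non-algebraic ones works: the
    coefficients of q-expansions, being of smaller degree, are algebraic or
    zero. *)
Lemma transcendental_truncation : valuation_transcendental nu_supp ->
  exists q, (1 < size q)%N /\ nu =1 truncation nu q.
Proof.
move=> trans.
pose P n := exists p, [/\ size p = n, p != 0 & ~ algebraic (tofrac p)].
have exP : exists n, P n.
  apply: NNPP => noP; apply: trans; apply/valuation_algebraicP => p p0.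
  by apply: NNPP => nalg; apply: noP; exists (size p), p.
have [n [q [szq q0 q_trans]] min_n] := least_nat exP.
have low_alg p : (size p < size q)%N -> tofrac p = 0 \/ algebraic (tofrac p).
  rewrite szq => lt_p; have [->|p0] := eqVneq p 0; first by left; rewrite tofrac0.
  right; apply: NNPP => nalg; suff : (n <= size p)%N by rewrite leqNgt lt_p.
  by apply: min_n; exists p.
have q1 : (1 < size q)%N.
  rewrite ltnNge; apply/negP => le_q1; apply: q_trans.
  rewrite (size1_polyC le_q1); apply: val_algebraic_iota.
  by rewrite -polyC_eq0 -size1_polyC.
exists q; split=> // p; apply/le_anti; rewrite truncation_le_val // andbT.
apply: le_bigmin; first exact: lex1.
move=> i _; have [pE _] := qexpansion_exists p q1.
have coefE j : (mkseq (qcoef q p) (size p))`_j = qcoef q p j.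
  exact: is_qexpansion_coef q1 (qexpansion_exists p q1).
have pE' : tofrac p = \sum_(j < size p) tofrac (qcoef q p j) * tofrac q ^+ j.
  rewrite {1}pE size_mkseq rmorph_sum; apply: eq_bigr => j _.
  by rewrite coefE rmorphM rmorphXn.
rewrite -(frac_val_tofrac nu_supp p) -(frac_val_tofrac nu_supp (_ * _)).
rewrite pE' rmorphM rmorphXn.
apply: (@val_sum_transcendental _ _ _ _ _ _ (K_to_Kx_val nu_supp) _ _
  (fun j => tofrac (qcoef q p j))) => // j _.
by apply: low_alg; rewrite ltn_modp.
Qed.

(** If q were algebraic, lifting an equation satisfied by the residue of the
    unit q^n b would produce a polynomial in q of positive value with a term of
    value 0. *)
Lemma truncation_transcendental q : (1 < size q)%N -> nu =1 truncation nu q ->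
  valuation_transcendental nu_supp.
Proof.
move=> q1 nuq /valuation_algebraicP /(_ q).
rewrite -size_poly_gt0 (ltnW q1) => /(_ isT) [n [b [n0]]].
pose y : {poly K} := q ^+ n * b%:P.
have -> : tofrac q ^+ n * K_to_Kx b = tofrac y by rewrite rmorphM rmorphXn.
rewrite [w _](frac_val_tofrac nu_supp) => nu_y [[P P0 root_P]].
have wy i : w (tofrac y ^+ i) = fin 0.
  by rewrite -rmorphXn [LHS](frac_val_tofrac nu_supp) valX_unit.
pose a i : K := val (repr P`_i).
have a_int i : fin 0 <= nuK nu (a i) by apply: (valP (repr P`_i)).
have res_a i : residue_of (nuK nu) (a i) = P`_i.
  by rewrite residue_of_val residue_classK.
(* f = sum_i a_i y^i, written as a polynomial in q so that its q-expansion can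
   be read off: the coefficient of q^(n j) is a_j b^j. *)
pose h := \poly_(i < size P) (a i * b ^+ i) : {poly K}.
pose f := (h \Po 'X^n) \Po q.
have fE : f = \sum_(i < size P) (a i)%:P * y ^+ i.
  rewrite /f -comp_polyA comp_Xn_poly /h poly_def raddf_sum.
  apply: eq_bigr => i _ /=; rewrite comp_polyZ comp_Xn_poly -mul_polyC.
  by rewrite polyCM polyC_exp /y exprMn; ring.
have nu_f : fin 0 < nu f.
  rewrite -(frac_val_tofrac nu_supp) fE rmorph_sum.
  pose z i := K_to_Kx (a i) * tofrac y ^+ i.
  rewrite (eq_bigr (fun i : 'I_(size P) => z i)) => [|i _]; last first.
    by rewrite rmorphM rmorphXn.
  have z_int i : fin 0 <= w (z i).
    by rewrite valM wy addr0 K_to_Kx_val; apply: a_int.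
  rewrite -[X in _ < X]/(w _) -residue_of_eq0; last exact: val_sum_ge.
  have y_int : fin 0 <= w (tofrac y) by rewrite (wy 1%N).
  by rewrite (residue_of_horner (K_to_Kx_val nu_supp) P y_int); apply: root_P.
have [j Pj] : exists j, P`_j != 0.
  by exists (size P).-1; rewrite -lead_coefE lead_coef_eq0.
have lt_j : (j < size P)%N.
  by rewrite ltnNge; apply: contra_neqN Pj => /(nth_default 0).
have := truncation_le f (n * j) q1; rewrite -nuq leNgt => /negP[].
apply: le_lt_trans nu_f; rewrite qcoef_comp // coef_comp_poly_Xn //.
rewrite dvdn_mulr // mulKn // coef_poly lt_j.
(* The term of index n j has value 0, for P`_j being nonzero makes a_j a unit. *)
have -> : (a j * b ^+ j)%:P * q ^+ (n * j) = (a j)%:P * y ^+ j.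
  by rewrite polyCM polyC_exp /y exprMn exprM; ring.
rewrite valM valX_unit // addr0 leNgt.
by rewrite -(residue_of_eq0 (a_int j)) res_a.
Qed.

End Polynomials.

Theorem theorem1p3 (K : fieldType) (Gamma : orderedGroupType)
    (nu : valuation {poly K} Gamma) (nu_supp : zero_support nu) :
  valuation_transcendental nu_supp <->
  exists q : {poly K}, (1 < size q)%N /\ nu =1 truncation nu q.
Proof.
split; first exact: transcendental_truncation.
by case=> q [q1 nuq]; apply: truncation_transcendental q1 nuq.
Qed.
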